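(* Let $R$ be a commutative ring with non-zero identity, $M$ a non-zero unital $R$-module and $N$ a proper submodule of $M$. The following statements are equivalent: (1) $N$ is a 1-absorbing prime submodule of $M$. (2) For any two proper ideals $I,J$ of $R$ and any proper submodule $K$ of $M$, if $IJK\subseteq N$, then either $IJ\subseteq (N:M)$ or $K\subseteq N$.
   Context: For a submodule $N$ of $M$, $(N:M)=\{r\in R: rM\subseteq N\}$. A proper submodule $N$ of $M$ is 1-absorbing prime if for all non-unit elements $a,b\in R$ and all $m\in M$, $abm\in N$ implies $ab\in(N:M)$ or $m\in N$. *)

(* Defs.v *)
From mathcomp Require Import all_boot all_order all_algebra.
From mathcomp Require Import boolp classical_sets.

Set Implicit Arguments.
Unset Strict Implicit.
Unset Printing Implicit Defensive.

Import GRing.Theory.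
Local Open Scope ring_scope.
Local Open Scope classical_set_scope.

(* [GRing.unit] is only available on rings with a chosen inverse; this makes
   sense in any commutative ring. *)
Definition is_unit (R : comNzRingType) (a : R) : Prop := exists b : R, a * b = 1.

(* Membership in a [set] is made boolean classically, so arbitrary subsets of M
   are covered by the library predicate. *)
Definition submodule (R : comNzRingType) (M : lmodType R) (N : set M) : Prop :=
  GRing.submod_closed [in N].

Definition proper_submodule (R : comNzRingType) (M : lmodType R) (N : set M) :
  Prop := submodule N /\ N <> [set: M].

(* [idealr_closed] requires that 1 is not in the set. *)
Definition is_proper_ideal (R : comNzRingType) (I : set R) : Prop :=
  idealr_closed [in I].

Definition ideal_mul (R : comNzRingType) (I J : set R) : set R :=
  [set x | exists (n : nat) (a b : 'I_n -> R),
     [/\ forall i, I (a i), forall i, J (b i) & x = \sum_(i < n) a i * b i]].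

Definition ideal_smul (R : comNzRingType) (M : lmodType R)
    (I : set R) (K : set M) : set M :=
  [set x | exists (n : nat) (a : 'I_n -> R) (k : 'I_n -> M),
     [/\ forall i, I (a i), forall i, K (k i) & x = \sum_(i < n) a i *: k i]].

(* The residual (N : M). *)
Definition colon (R : comNzRingType) (M : lmodType R) (N : set M) : set R :=
  [set r | [set r *: m | m in [set: M]] `<=` N].

Definition one_absorbing_prime (R : comNzRingType) (M : lmodType R)
    (N : set M) : Prop :=
  proper_submodule N /\
  forall (a b : R) (m : M), ~ is_unit a -> ~ is_unit b ->
    N ((a * b) *: m) -> colon N (a * b) \/ N m.

(* Main.v *)
(* For (1) => (2), an element m of K outside N forces every product ab with
   a in I and b in J into (N : M), which is closed under sums. For (2) => (1),
   take I = Ra, J = Rb and K = Rm; the case Rm = M, in which K is not proper,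
   is settled directly, since then abm in N already gives abM <= N. *)

Require Import Defs.
From mathcomp Require Import all_boot all_order all_algebra.
From mathcomp Require Import boolp classical_sets.

Set Implicit Arguments.
Unset Strict Implicit.
Unset Printing Implicit Defensive.

Import GRing.Theory.
Local Open Scope ring_scope.
Local Open Scope classical_set_scope.

(** Trades the boolean membership in [submod_closed] for plain propositions, so that closure applies
    directly to hypotheses [N x]. *)
Lemma submoduleP (R : comNzRingType) (M : lmodType R) (N : set M) :
  submodule N <->
  N 0 /\ forall (r : R) (x y : M), N x -> N y -> N (r *: x + y).
Proof.
split=> [[N0 NL]|[N0 NL]]; split; rewrite ?inE //.
- by move: N0; rewrite !inE.
- move=> r x y Nx Ny; have := NL r x y; rewrite !inE; exact.
- by move=> r x y; rewrite !inE; exact: NL.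
Qed.

Lemma submoduleZ (R : comNzRingType) (M : lmodType R) (N : set M) (r : R)
    (x : M) : submodule N -> N x -> N (r *: x).
Proof. by move=> /submoduleP[N0 NL] Nx; rewrite -[_ *: x]addr0; exact: NL. Qed.

Lemma submodule_sum (R : comNzRingType) (M : lmodType R) (N : set M) (n : nat)
    (f : 'I_n -> M) : submodule N -> (forall i, N (f i)) -> N (\sum_(i < n) f i).
Proof.
move=> /submoduleP[N0 NL] Nf; apply: big_ind => // x y Nx Ny.
by rewrite -[x]scale1r; exact: NL.
Qed.

Lemma proper_idealP (R : comNzRingType) (I : set R) :
  is_proper_ideal I <->
  [/\ I 0, ~ I 1 & forall r x y : R, I x -> I y -> I (r * x + y)].
Proof.
split=> [[I0 I1 IL]|[I0 I1 IL]]; split.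
- by move: I0; rewrite !inE.
- by move: I1 => /negP; rewrite !inE.
- move=> r x y Ix Iy; have := IL r x y; rewrite !inE; exact.
- by rewrite !inE.
- by apply/negP; rewrite !inE.
- by move=> r x y; rewrite !inE; exact: IL.
Qed.

(** An inverse of [a] would put 1 into [I]. This makes elements of proper ideals eligible for the
    1-absorbing condition. *)
Lemma proper_ideal_nonunit (R : comNzRingType) (I : set R) (a : R) :
  is_proper_ideal I -> I a -> ~ is_unit a.
Proof.
move=> /proper_idealP[I0 I1 IL] Ia [b ab1]; apply: I1.
by rewrite -ab1 mulrC -[b * a]addr0; exact: IL.
Qed.

(** Only a unit [a] can have 1 among its multiples, by commutativity. *)
Lemma principal_proper_ideal (R : comNzRingType) (a : R) :
  ~ is_unit a -> is_proper_ideal [set r * a | r in [set: R]].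
Proof.
move=> aN; apply/proper_idealP; split.
- by exists 0 => //; rewrite mul0r.
- by move=> [b _ ba1]; apply: aN; exists b; rewrite mulrC.
- by move=> r _ _ [s _ <-] [t _ <-]; exists (r * s + t) => //; rewrite mulrDl mulrA.
Qed.

Lemma cyclic_submodule (R : comNzRingType) (M : lmodType R) (m : M) :
  submodule [set r *: m | r in [set: R]].
Proof.
apply/submoduleP; split; first by exists 0 => //; rewrite scale0r.
move=> r _ _ [s _ <-] [t _ <-]; exists (r * s + t) => //.
by rewrite scalerDl scalerA.
Qed.

Lemma mem_ideal_mul (R : comNzRingType) (I J : set R) (a b : R) :
  I a -> J b -> ideal_mul I J (a * b).
Proof.
by move=> Ia Jb; exists 1%N, (fun=> a), (fun=> b); split=> //; rewrite big_ord1.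
Qed.

Lemma mem_ideal_smul (R : comNzRingType) (M : lmodType R) (I : set R)
    (K : set M) (a : R) (k : M) : I a -> K k -> ideal_smul I K (a *: k).
Proof.
by move=> Ia Kk; exists 1%N, (fun=> a), (fun=> k); split=> //; rewrite big_ord1.
Qed.

Theorem theorem1 (R : comNzRingType) (M : lmodType R)
    (hM : exists m : M, m <> 0) (N : set M) (hN : proper_submodule N) :
  one_absorbing_prime N <->
  (forall (I J : set R) (K : set M),
     is_proper_ideal I -> is_proper_ideal J -> proper_submodule K ->
     ideal_smul (ideal_mul I J) K `<=` N ->
     ideal_mul I J `<=` colon N \/ K `<=` N).
Proof.
have [Nsub _] := hN; split=> [[_ N1] I J K II JI _ IJK|NIJK].
- have [KN|KN] := pselect (K `<=` N); [by right|left].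
  (* The witness is fixed before any element of [IJ] is chosen, so the same [m] serves every summand
     [a i * b i]. *)
  have [m Km Nm] : exists2 m, K m & ~ N m.
    by move/existsNP: KN => [m /not_implyP[]]; exists m.
  move=> _ [n [a [b [Ia Jb ->]]]] _ [x _ <-].
  rewrite scaler_suml; apply: submodule_sum => // i.
  have abm : N ((a i * b i) *: m).
    by apply: IJK; apply: mem_ideal_smul => //; exact: mem_ideal_mul.
  (* The alternative [N m] contradicts the choice of [m], so [a i * b i] lies in [(N : M)] and can
     be applied to the arbitrary [x]. *)
  have [|//] := N1 _ _ _ (proper_ideal_nonunit II (Ia i))
    (proper_ideal_nonunit JI (Jb i)) abm.
  by apply; exists x.
- split=> // a b m aN bN abm.
  have [mM|mM] := pselect ([set r *: m | r in [set: R]] = [set: M]).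
    left=> _ [x _ <-].
    (* Writing x = rm gives (ab)x = r(abm), a multiple of an element of [N]. *)
    have [r _ <-] : [set r *: m | r in [set: R]] x by rewrite mM.
    by rewrite scalerA mulrC -scalerA; exact: submoduleZ.
  have [|IJ|K] := NIJK _ _ _ (principal_proper_ideal aN)
    (principal_proper_ideal bN) (conj (cyclic_submodule m) mM).
  (* Both layers of sums are opened: the outer one over products [c i *: k i], the inner one over
     the summands of [c i] in (Ra)(Rb). *)
  + move=> _ [n [c [k [IJc Kk ->]]]]; apply: submodule_sum => // i.
    have [s _ <-] := Kk i.
    have [p [u [v [Iu Jv ->]]]] := IJc i.
    rewrite scaler_suml; apply: submodule_sum => // j.
    have [t _ <-] := Iu j; have [w _ <-] := Jv j.
    (* Regroups (ta)(wb)(sm) as (tws)(abm). *)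
    rewrite scalerA mulrACA [_ * s]mulrAC -scalerA.
    exact: submoduleZ.
  + by left; apply: IJ; apply: mem_ideal_mul; exists 1; rewrite ?mul1r.
  + by right; apply: K; exists 1; rewrite ?scale1r.
Qed.
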